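(* Let $0<\sigma<1$ and let $u$ be a solution of $E_\sigma u=0$ in $\Omega\times(0,\infty)$, where $E_\sigma=-L+\frac{1-2\sigma}{y}\partial_y+\partial_{yy}$. If $v_1,\ldots,v_n:\Omega\times(0,\infty)\to\mathbb{R}$ verify the Cauchy–Riemann equations $$\left\{\begin{aligned} y^{1-2\sigma}\partial_yu&=D_1^\ast v_1+\cdots+D_n^\ast v_n,\\ D_iu&=y^{-(1-2\sigma)}\partial_yv_i,&&i=1,\ldots,n,\\ D_kv_i&=D_iv_k,&&i,k=1,\ldots,n, \end{aligned}\right.$$ then each $v_i$ solves the $i$th conjugate equation $$-Lv_i+[D_i^\ast,D_i]v_i-\frac{1-2\sigma}{y}\,\partial_yv_i+\partial_{yy}v_i=0,\qquad i=1,\ldots,n,$$ where $[D_i^\ast,D_i]=D_i^\ast D_i-D_iD_i^\ast$.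
   Context: Setting: $\Omega\subset\mathbb{R}^n$ ($n\ge1$) is open, $d\eta$ is a positive measure on $\Omega$, and $L$ is a linear second order partial differential operator which is nonnegative, densely defined and self-adjoint in $L^2(\Omega,d\eta)$. It is assumed that $L$ can be factorized as $L=\sum_{i=1}^nD_i^\ast D_i$, where $D_i=a_i(x_i)\partial_{x_i}+b_i(x_i)$ is a one dimensional (in the $i$th direction) partial differential operator, and $D_i^\ast$ is the formal adjoint of $D_i$ with respect to $d\eta$. The operators $L$, $D_i$, $D_i^\ast$ act in the variable $x\in\Omega$. The functions $u,v_1,\dots,v_n$ are assumed regular enough for the derivatives involved to make sense.
   Formalization: It is additionally assumed that each formal adjoint D_i^* is itself a one-dimensional operator in the ith direction, with coefficients depending on x_i only (as for product measures); without this the claim fails, e.g. for D_i = ∂_i and dη = e^{x_1x_2}dx in the plane. *)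

(* Defs.v *)
From HB Require Import structures.
From mathcomp Require Import all_boot all_order all_algebra.
From mathcomp Require Import all_classical all_reals all_analysis.

Set Implicit Arguments.
Unset Strict Implicit.
Unset Printing Implicit Defensive.

Import Order.TTheory GRing.Theory Num.Theory.
Import numFieldNormedType.Exports.

Local Open Scope ring_scope.
Local Open Scope classical_set_scope.


(* In finite dimension, asking for the derivatives along all directions is the
   same as asking for the partial derivatives; this form also covers functions
   on R and on R^n * R. Meant for open U. *)
Fixpoint Ck (R : realType) (V : normedModType R) (k : nat) (U : set V)
    (f : V -> R) : Prop :=
  (forall x, U x -> {for x, continuous f}) /\
  (if k is k'.+1 then
     forall v : V, (forall x, U x -> derivable f x v) /\ Ck k' U ('D_v f)
   else True).

(* R^n with its Borel sigma-algebra *)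
Definition borelRn (R : realType) (n : nat) :=
  g_sigma_algebraType (@open 'rV[R]_n).

Section Operators.
Variables (R : realType) (n : nat).
Implicit Types (i : 'I_n) (Omega : set 'rV[R]_n) (f g : 'rV[R]_n -> R).
Implicit Types (S T L : ('rV[R]_n -> R) -> 'rV[R]_n -> R).

Definition partial i f : 'rV[R]_n -> R := 'D_(delta_mx 0 i) f.

Definition coord_range Omega i : set R := [set x 0 i | x in Omega].

(* the operator  a(x_i) d/dx_i + b(x_i) *)
Definition onedim_op i (a b : R -> R) f : 'rV[R]_n -> R :=
  fun x => a (x 0 i) * partial i f x + b (x 0 i) * f x.

Definition commutator S T f : 'rV[R]_n -> R :=
  fun x => S (T f) x - T (S f) x.

Definition second_order_pdo Omega L : Prop :=
  exists (A : 'I_n -> 'I_n -> 'rV[R]_n -> R) (B : 'I_n -> 'rV[R]_n -> R)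
         (C : 'rV[R]_n -> R),
  forall f, Ck 2 Omega f -> forall x, Omega x ->
    L f x = \sum_(i < n) \sum_(j < n) A i j x * partial i (partial j f) x
            + \sum_(i < n) B i x * partial i f x + C x * f x.

Definition test_function Omega : set ('rV[R]_n -> R) :=
  [set f | [/\ forall k, Ck k setT f,
               compact (closure [set x | f x != 0])
             & closure [set x | f x != 0] `<=` Omega]].

Definition dy (u : 'rV[R]_n -> R -> R) : 'rV[R]_n -> R -> R :=
  fun x => derive1 (u x).

(* -L + (1 - 2s)/y d/dy + d^2/dy^2, where L acts in the variable x *)
Definition extension_op L (s : R) (u : 'rV[R]_n -> R -> R) x (y : R) : R :=
  - L (u ^~ y) x + (1 - 2 * s) / y * dy u x y + dy (dy u) x y.

End Operators.

Section L2.
Variables (R : realType) (n : nat).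
Variables (Omega : set 'rV[R]_n)
          (eta : {measure set (borelRn R n) -> \bar R}).
Implicit Types (f g h : 'rV[R]_n -> R) (dom : set ('rV[R]_n -> R)).
Implicit Types (S T L : ('rV[R]_n -> R) -> 'rV[R]_n -> R).

Definition square_integrable : set ('rV[R]_n -> R) :=
  [set f | measurable_fun (Omega : set (borelRn R n)) (f : borelRn R n -> R) /\
           eta.-integrable Omega (fun x => (f x ^+ 2)%:E)].

Definition inner f g : R := \int[eta]_(x in Omega) (f x * g x).

Definition ae_equal f g : Prop :=
  ae_eq eta Omega (f : borelRn R n -> R) (g : borelRn R n -> R).

Definition formal_adjoint S T : Prop :=
  forall f g, test_function Omega f -> test_function Omega g ->
    inner (S f) g = inner f (T g).

(* A (possibly unbounded) operator in L^2(Omega, eta) is given by a set dom of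
   representatives and by the action of L on dom; linearity is understood up
   to null sets. *)
Definition L2_operator dom L : Prop :=
  [/\ dom `<=` square_integrable,
      forall f, dom f -> square_integrable (L f),
      dom (cst 0)
    & forall (c : R) f g, dom f -> dom g ->
        dom (fun x => c * f x + g x) /\
        ae_equal (L (fun x => c * f x + g x)) (fun x => c * L f x + L g x)].

Definition densely_defined dom : Prop :=
  forall f, square_integrable f -> forall e : R, 0 < e ->
    exists2 g, dom g & inner (fun x => f x - g x) (fun x => f x - g x) < e.

Definition nonnegative_op dom L : Prop :=
  forall f, dom f -> 0 <= inner (L f) f.

(* L and its Hilbert space adjoint have the same graph; in particular dom is
   saturated for equality almost everywhere. *)
Definition selfadjoint_op dom L : Prop :=
  forall g h, square_integrable g -> square_integrable h ->
    (dom g /\ ae_equal (L g) h) <->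
    (forall f, dom f -> inner (L f) g = inner f h).

End L2.

(* Main.v *)
Require Import Defs.
From HB Require Import structures.
From mathcomp Require Import all_boot all_order all_algebra.
From mathcomp Require Import all_classical all_reals all_analysis.
From mathcomp Require Import ring.
Import Order.TTheory GRing.Theory Num.Theory.
Import numFieldNormedType.Exports.

Local Open Scope ring_scope.
Local Open Scope classical_set_scope.

(** The second system of equations reads [dy v_i = y^(1-2s) D_i u].  Its
    derivative in [y] is [(1-2s)/y dy v_i + D_i (y^(1-2s) dy u)], because [D_i]
    and [dy] commute, and the first equation turns the last term into
    [sum_k D_i D_k^* v_k].  For [k <> i] the operators [D_i] and [D_k^*] act in
    different variables, hence commute, and [D_i v_k = D_k v_i] leaves
    [D_k^* D_k v_i]; the term [k = i] differs from [D_i^* D_i v_i] by the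
    commutator.  Both commutations rest on the symmetry of second derivatives. *)

(** * Directional derivatives of functions that agree along lines *)

Section Line.
Variables (R : realType) (V V' : normedModType R).
Variables (f : V -> R) (g : V' -> R) (x v : V) (x' v' : V').
Hypothesis fg : forall h : R, f (h *: v + x) = g (h *: v' + x').

(** Difference quotients involve only the values along the two lines, and [fg] at [h = 0] matches
    the base points. This carries derivatives between R, R^n and R^n x R. *)
Let quotient_eq :
  (fun h : R => h^-1 *: ((f \o shift x) (h *: v) - f x)) =
  (fun h : R => h^-1 *: ((g \o shift x') (h *: v') - g x')).
Proof.
apply/funext => h /=; rewrite fg.
by have := fg 0; rewrite !scale0r !add0r => ->.
Qed.

Lemma derive_eq_along : 'D_v f x = 'D_v' g x'.
Proof. by rewrite /derive quotient_eq. Qed.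

Lemma derivable_eq_along : derivable f x v -> derivable g x' v'.
Proof. by rewrite /derivable quotient_eq. Qed.

Lemma is_derive_eq_along (df : R) : is_derive x v f df -> is_derive x' v' g df.
Proof.
move=> [fxv dfE]; apply: DeriveDef; first exact: derivable_eq_along.
by rewrite -derive_eq_along.
Qed.

End Line.

(** * Symmetry of second directional derivatives *)

Section Schwarz.
Variables (R : realType) (V : normedModType R).
Implicit Types (U : set V) (f : V -> R) (x v w : V).

Lemma MVT_along f x v (h : R) : 0 < h ->
  (forall t, 0 <= t <= h -> derivable f (t *: v + x) v) ->
  exists2 c, 0 < c < h & f (h *: v + x) - f x = 'D_v f (c *: v + x) * h.
Proof.
move=> h0 fd; pose g t := f (t *: v + x).
have gd t : 0 <= t <= h -> is_derive t 1 g ('D_v f (t *: v + x)).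
  move=> /fd/derivableP; apply: is_derive_eq_along => k.
  by rewrite /g scalerDl addrA; congr (f (_ *: v + _ + _)); rewrite [k%:A]mulr1.
have [t||c] := @MVT R g (fun t => 'D_v f (t *: v + x)) 0 h h0.
- by rewrite in_itv/= => /andP[t0 th]; apply: gd; rewrite !ltW.
- apply: derivable_within_continuous => t; rewrite in_itv/= => th.
  exact: (@ex_derive _ _ _ _ _ _ _ (gd t th)).
- rewrite in_itv/= => ch; rewrite /g scale0r add0r subr0 => gE.
  by exists c.
Qed.

(** Two mean value theorems: first along [v] for [phi], the increment of [f] in direction [w], then
    along [w] for ['D_v f]. *)
Lemma double_difference f x v w (h : R) : 0 < h ->
  (forall s t, 0 <= s <= h -> 0 <= t <= h ->
    derivable f (s *: v + t *: w + x) v /\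
    derivable ('D_v f) (s *: v + t *: w + x) w) ->
  exists s t, [/\ 0 <= s <= h, 0 <= t <= h &
    f (h *: v + h *: w + x) - f (h *: v + x) - f (h *: w + x) + f x =
    'D_w ('D_v f) (s *: v + t *: w + x) * h * h].
Proof.
move=> h0 fd; have h00 : 0 <= (0 : R) <= h by apply/andP; split; [exact: lexx|exact: ltW].
have h0h : 0 <= h <= h by apply/andP; split; [exact: ltW|exact: lexx].
pose phi z := f (h *: w + z) - f z.
have phid s : 0 <= s <= h -> is_derive (s *: v + x) v phi
    ('D_v f (s *: v + h *: w + x) - 'D_v f (s *: v + x)).
  move=> sh; apply: is_deriveB.
    have /derivableP := (fd s h sh h0h).1; apply: is_derive_eq_along => k.
    by rewrite -[s *: v + _ + _]addrA [s *: v + (_ + _)]addrCA [k *: v + _]addrCA.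
  have /derivableP := (fd s 0 sh h00).1.
  by rewrite scale0r addr0.
have [s sh phiE] := @MVT_along phi x v h h0
  (fun s sh => @ex_derive _ _ _ _ _ _ _ (phid s sh)).
have sh' : 0 <= s <= h by case/andP: sh => s0 sh; rewrite !ltW.
have [|t th dE] := @MVT_along ('D_v f) (s *: v + x) w h h0.
  by move=> t th; have := (fd s t sh' th).2; rewrite [_ *: v + _]addrC addrA.
exists s, t; split => //; first by case/andP: th => t0 th; rewrite !ltW.
move: phiE; rewrite (@derive_val _ _ _ _ _ _ _ (phid s sh')).
have -> : s *: v + h *: w + x = h *: w + (s *: v + x) by rewrite addrCA addrA.
rewrite dE /phi.
have -> : s *: v + t *: w + x = t *: w + (s *: v + x) by rewrite addrCA addrA.
move=> <-.
have -> : h *: v + h *: w + x = h *: w + (h *: v + x) by rewrite addrCA addrA.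
by ring.
Qed.

Lemma nbhs_parallelogram x v w (P : set V) : nbhs x P ->
  exists2 h : R, 0 < h & forall s t, 0 <= s <= h -> 0 <= t <= h ->
    P (s *: v + t *: w + x).
Proof.
move=> /nbhs_ballP[r /= r0 rP].
have n0 : 0 < `|v| + `|w| + 1 by rewrite ltr_wpDl// addr_ge0.
(* The summand 1 keeps the denominator positive even when [v] and [w] vanish, and makes the final
   bound strict. *)
exists (r / (`|v| + `|w| + 1)); first exact: divr_gt0.
set h := (r / _) => s t /andP[s0 sh] /andP[t0 th]; apply: rP.
have h0 : 0 < h by exact: divr_gt0.
rewrite -ball_normE /= opprD addrCA subrr addr0 normrN.
have le1 : `|s *: v| <= h * `|v| by rewrite normrZ ger0_norm// ler_wpM2r.
have le2 : `|t *: w| <= h * `|w| by rewrite normrZ ger0_norm// ler_wpM2r.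
apply: (le_lt_trans (ler_normD _ _)); apply: (le_lt_trans (lerD le1 le2)).
have rE : r = h * (`|v| + `|w| + 1) by rewrite /h divfK// gt_eqF.
by rewrite -mulrDr [ltRHS]rE ltr_pM2l// ltrDl.
Qed.

(** If the values at [x] differed, continuity would keep each mixed derivative within half the gap
    of its own value on a small parallelogram. But the double difference is unchanged when [v] and
    [w] are swapped, so some value of one derivative there equals some value of the other. *)
Lemma Ck2_derive_comm U f x v w : open U -> Ck 2 U f -> U x ->
  'D_w ('D_v f) x = 'D_v ('D_w f) x.
Proof.
move=> Uopen [_ f2] Ux.
have [fv [_ fv2]] := f2 v; have [fw [_ fw2]] := f2 w.
have [fvw [cvw _]] := fv2 w; have [fwv [cwv _]] := fw2 v.
apply/eqP; rewrite -subr_eq0; apply/negPn/negP => neq.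
set A := 'D_w ('D_v f) in cvw neq *; set B := 'D_v ('D_w f) in cwv neq *.
pose e := `|A x - B x| / 2.
have e0 : 0 < e by rewrite divr_gt0 ?normr_gt0.
have nU : nbhs x U by exact: open_nbhs_nbhs.
have nA : nbhs x [set z | `|A x - A z| < e].
  by have /cvgrPdist_lt/(_ _ e0) := cvw x Ux.
have nB : nbhs x [set z | `|B x - B z| < e].
  by have /cvgrPdist_lt/(_ _ e0) := cwv x Ux.
have [h h0 hP] := @nbhs_parallelogram x v w _ (filterI nU (filterI nA nB)).
have [|s [t [sh th dA]]] := @double_difference f x v w h h0.
  by move=> s t sh th; have [Uz _] := hP s t sh th; split; [exact: fv|exact: fvw].
have [|t' [s' [th' sh' dB]]] := @double_difference f x w v h h0.
  move=> t' s' th' sh'; rewrite [t' *: w + _]addrC.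
  by have [Uz _] := hP s' t' sh' th'; split; [exact: fw|exact: fwv].
have [_ [Az _]] := hP s t sh th.
have [_ [_ Bz]] := hP s' t' sh' th'.
have AB : A (s *: v + t *: w + x) = B (s' *: v + t' *: w + x).
  apply: (mulIf (lt0r_neq0 h0)); apply: (mulIf (lt0r_neq0 h0)).
  rewrite (addrC (t' *: w)) (addrC (h *: w)) in dB.
  by apply: etrans (esym dA) (etrans _ dB); congr (_ + _); rewrite addrAC.
have : `|A x - B x| < e + e.
  rewrite -(subrK (A (s *: v + t *: w + x)) (A x)) -addrA.
  apply: (le_lt_trans (ler_normD _ _)); apply: ltrD; first exact: Az.
  by rewrite AB distrC; exact: Bz.
by rewrite /e -splitr ltxx.
Qed.

End Schwarz.

(** Induction on [k]: the derivative of a slice along [v] is the slice of the joint derivative along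
    [(v, 0)]. *)
Lemma Ck_slice (R : realType) (V W : normedModType R) (k : nat) (A : set V)
    (B : set W) (f : V -> W -> R) (y : W) : B y ->
  Ck k (A `*` B) (fun p => f p.1 p.2) -> Ck k A (f ^~ y).
Proof.
move=> By; elim: k f => [|k IH] f [fc fk]; split => //.
1,2: move=> x Ax; apply: (@continuous_comp _ _ _ (fun z => (z, y))
       (fun p => f p.1 p.2)); last exact: fc.
1,2: by apply: cvg_pair; [exact: cvg_id|exact: cvg_cst].
move=> v; have [fd fv] := fk (v, 0).
have sliceE (x : V) (h : R) : (fun p => f p.1 p.2) (h *: (v, 0 : W) + (x, y)) =
    (f ^~ y) (h *: v + x) by rewrite /= scaler0 add0r.
split=> [x Ax|].
  exact: (@derivable_eq_along _ _ _ _ _ _ _ _ _ (sliceE x) (fd (x, y) _)).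
pose g x y := 'D_(v, 0) (fun p : V * W => f p.1 p.2) (x, y).
have -> : 'D_v (f ^~ y) = g ^~ y.
  by apply/funext => x; exact/esym/derive_eq_along.
apply: IH; have -> // : (fun p => g p.1 p.2) = 'D_(v, 0) (fun p => f p.1 p.2).
by apply/funext => -[].
Qed.

Lemma open_setX (S T : topologicalType) (A : set S) (B : set T) :
  open A -> open B -> open (A `*` B).
Proof.
move=> Ao Bo; rewrite openE => -[x y] [/= Ax By].
by exists (A, B) => //=; split; exact: open_nbhs_nbhs.
Qed.

Lemma pair_alongl (R : realType) (V W : normedModType R) (v x : V) (y : W)
    (h : R) : h *: (v, 0) + (x, y) = (h *: v + x, y).
Proof. by congr pair; rewrite /= scaler0 add0r. Qed.

Lemma pair_alongr (R : realType) (V W : normedModType R) (w y : W) (x : V)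
    (h : R) : h *: (0, w) + (x, y) = (x, h *: w + y).
Proof. by congr pair; rewrite /= scaler0 add0r. Qed.

(** * First order operators in a single coordinate *)

Section OneDim.
Variables (R : realType) (n : nat).
Implicit Types (i k : 'I_n) (Omega : set 'rV[R]_n) (f g : 'rV[R]_n -> R).

Lemma coord_along i (x : 'rV[R]_n) (h : R) :
  (h *: delta_mx 0 i + x) 0 i = h *: 1 + x 0 i.
Proof. by rewrite !mxE !eqxx. Qed.

Lemma coord_along_neq i k (x : 'rV[R]_n) (h : R) : k != i ->
  (h *: delta_mx 0 i + x) 0 k = x 0 k.
Proof. by move=> ki; rewrite !mxE (negPf ki) andbF mulr0 add0r. Qed.

(** Lets the operator be applied to both sides of an equation that holds only on an open set. *)
Lemma near_eq_onedim_op i (a b : R -> R) f g (x : 'rV[R]_n) :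
  (\forall z \near x, f z = g z) ->
  onedim_op i a b f x = onedim_op i a b g x.
Proof.
move=> fg; rewrite /onedim_op /partial (near_eq_derive _ fg).
by rewrite (nbhs_singleton fg).
Qed.

Lemma onedim_opZ i (a b : R -> R) (c : R) f (x : 'rV[R]_n) :
  derivable f x (delta_mx 0 i) ->
  onedim_op i a b (fun z => c * f z) x = c * onedim_op i a b f x.
Proof.
move=> fd; rewrite /onedim_op /partial (deriveMl c fd) /=.
by ring.
Qed.

Lemma onedim_op_sum i (a b : R -> R) (F : 'I_n -> 'rV[R]_n -> R)
    (x : 'rV[R]_n) : (forall k, derivable (F k) x (delta_mx 0 i)) ->
  onedim_op i a b (fun z => \sum_(k < n) F k z) x =
  \sum_(k < n) onedim_op i a b (F k) x.
Proof.
move=> Fd; rewrite /onedim_op /partial.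
have -> : (fun z => \sum_(k < n) F k z) = \sum_(k < n) F k.
  by apply/funext => z; rewrite fct_sumE.
by rewrite derive_sum// !mulr_sumr -big_split.
Qed.

(* The coefficients depend on x_k only, so they are constant along e_i. *)
Lemma is_derive_onedim_op_neq Omega i k (a b : R -> R) f (x : 'rV[R]_n) :
  open Omega -> Ck 2 Omega f -> Omega x -> k != i ->
  is_derive x (delta_mx 0 i) (onedim_op k a b f)
    (onedim_op k a b (partial i f) x).
Proof.
move=> Oo fC2 Ox ki.
have [_ f2] := fC2; have [fd _] := f2 (delta_mx 0 i).
have [_ [_ fk2]] := f2 (delta_mx 0 k); have [fkd _] := fk2 (delta_mx 0 i).
pose g z := a (x 0 k) * partial k f z + b (x 0 k) * f z.
have gd : is_derive x (delta_mx 0 i) g (onedim_op k a b (partial i f) x).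
  have -> : onedim_op k a b (partial i f) x =
      a (x 0 k) *: 'D_(delta_mx 0 i) (partial k f) x +
      b (x 0 k) *: 'D_(delta_mx 0 i) f x.
    by rewrite /onedim_op /partial (Ck2_derive_comm _ _ _ _ _ _ _ Oo fC2 Ox).
  by apply: is_deriveD; apply: is_deriveZ; apply: derivableP;
    [exact: fkd|exact: fd].
apply: is_derive_eq_along gd => h.
by rewrite /g /onedim_op coord_along_neq.
Qed.

(** Both compositions expand into the same four terms, up to the order of the mixed partial
    derivative. *)
Lemma onedim_op_comm Omega i k (a b a' b' : R -> R) f (x : 'rV[R]_n) :
  open Omega -> Ck 2 Omega f -> Omega x -> k != i ->
  onedim_op i a b (onedim_op k a' b' f) x =
  onedim_op k a' b' (onedim_op i a b f) x.
Proof.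
move=> Oo fC2 Ox ki; have ik : i != k by rewrite eq_sym.
have [_ dik] := is_derive_onedim_op_neq _ _ _ a' b' _ _ Oo fC2 Ox ki.
have [_ dki] := is_derive_onedim_op_neq _ _ _ a b _ _ Oo fC2 Ox ik.
rewrite {1}/onedim_op [in LHS]/partial dik.
rewrite [RHS]/onedim_op [in RHS]/partial dki.
rewrite /onedim_op /partial (Ck2_derive_comm _ _ _ _ _ _ _ Oo fC2 Ox).
by ring.
Qed.

(** Along its own direction the coefficients vary as well, so the product rule uses their
    derivability on the coordinate range. *)
Lemma derivable_onedim_op Omega i (a b : R -> R) f (x : 'rV[R]_n) :
  Ck 1 (coord_range Omega i) a -> Ck 1 (coord_range Omega i) b ->
  Ck 2 Omega f -> Omega x ->
  derivable (onedim_op i a b f) x (delta_mx 0 i).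
Proof.
move=> [_ /(_ 1)[ad _]] [_ /(_ 1)[bd _]] [_ /(_ (delta_mx 0 i))[fd fC1]] Ox.
have [_ /(_ (delta_mx 0 i))[fid _]] := fC1.
have xi : coord_range Omega i (x 0 i) by exists x.
have coordd (c : R -> R) : derivable c (x 0 i) 1 ->
    derivable (fun z : 'rV[R]_n => c (z 0 i)) x (delta_mx 0 i).
  by apply: derivable_eq_along => h; rewrite coord_along.
apply: derivableD; apply: derivableM.
- exact: coordd (ad _ xi).
- exact: fid.
- exact: coordd (bd _ xi).
- exact: fd.
Qed.

(** * Derivatives of functions on the product of [Omega] with the open half-line *)

Section Half.
Variables (Omega : set 'rV[R]_n) (u : 'rV[R]_n -> R -> R).
Hypothesis Omega_open : open Omega.
Hypothesis u_C2 :
  Ck 2 (Omega `*` [set y : R | 0 < y]) (fun p => u p.1 p.2).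

Let U (p : 'rV[R]_n * R) := u p.1 p.2.

Let half_open : open (Omega `*` [set y : R | 0 < y]).
Proof. by apply: open_setX => //. Qed.

(** Slice derivatives are rewritten as directional derivatives of the joint function [U], to which
    the symmetry of second derivatives applies. *)
Lemma dyE x (y : R) : dy u x y = 'D_(0, 1) U (x, y).
Proof.
rewrite /dy derive1E; apply: derive_eq_along => h.
by rewrite /U /= scaler0 add0r.
Qed.

Lemma partial_sliceE i x (y : R) :
  partial i (u ^~ y) x = 'D_(delta_mx 0 i, 0) U (x, y).
Proof. by apply: derive_eq_along => h; rewrite /U /= scaler0 add0r. Qed.

Lemma partial_dyE i x (y : R) :
  partial i (dy u ^~ y) x = 'D_(delta_mx 0 i, 0) ('D_(0, 1) U) (x, y).
Proof. by apply: derive_eq_along => h; rewrite dyE pair_alongl. Qed.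

Lemma derivable_dy i x (y : R) : Omega x -> 0 < y ->
  derivable (dy u ^~ y) x (delta_mx 0 i).
Proof.
move=> Ox y0; have [_ /(_ (0, 1))[_ [_ /(_ (delta_mx 0 i, 0))[Ud _]]]] := u_C2.
apply: derivable_eq_along (Ud (x, y) _) => // h.
by rewrite dyE pair_alongl.
Qed.

(** The coefficients do not depend on [y], so it suffices to swap the mixed derivatives of [U]. *)
Lemma is_derive_onedim_op_y i (a b : R -> R) x (y : R) : Omega x -> 0 < y ->
  is_derive y 1 (fun y' => onedim_op i a b (u ^~ y') x)
    (onedim_op i a b (dy u ^~ y) x).
Proof.
move=> Ox y0; have Wxy : (Omega `*` [set y : R | 0 < y]) (x, y) by [].
have [_ U2] := u_C2; have [Ud _] := U2 (0, 1).
have [_ [_ /(_ (0, 1))[Uid _]]] := U2 (delta_mx 0 i, 0).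
have -> : onedim_op i a b (dy u ^~ y) x =
    a (x 0 i) *: 'D_(delta_mx 0 i, 0) ('D_(0, 1) U) (x, y) +
    b (x 0 i) *: 'D_(0, 1) U (x, y).
  by rewrite /onedim_op dyE partial_dyE.
rewrite -(Ck2_derive_comm _ _ _ _ _ _ _ half_open u_C2 Wxy).
apply: is_deriveD; apply: is_deriveZ.
  apply: is_derive_eq_along (derivableP (Uid _ Wxy)) => h.
  by rewrite partial_sliceE pair_alongr.
apply: is_derive_eq_along (derivableP (Ud _ Wxy)) => h.
by rewrite /= scaler0 add0r.
Qed.

End Half.
End OneDim.

Theorem proposition2p7 (R : realType) (n : nat) (n_gt0 : (0 < n)%N)
  (Omega : set 'rV[R]_n) (Omega_open : open Omega)
  (eta : {measure set (borelRn R n) -> \bar R})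
  (* the operator L, with its domain in L^2(Omega, eta) *)
  (L : ('rV[R]_n -> R) -> 'rV[R]_n -> R) (dom : set ('rV[R]_n -> R))
  (L_pdo : second_order_pdo Omega L)
  (L_op : L2_operator Omega eta dom L)
  (L_test : test_function Omega `<=` dom)
  (L_dense : densely_defined Omega eta dom)
  (L_nonneg : nonnegative_op Omega eta dom L)
  (L_selfadj : selfadjoint_op Omega eta dom L)
  (* D_i and its formal adjoint D_i^*, both acting in the i-th direction *)
  (a b astar bstar : 'I_n -> R -> R)
  (a_C1 : forall i, Ck 1 (coord_range Omega i) (a i))
  (b_C1 : forall i, Ck 1 (coord_range Omega i) (b i))
  (astar_C1 : forall i, Ck 1 (coord_range Omega i) (astar i))
  (bstar_C1 : forall i, Ck 1 (coord_range Omega i) (bstar i))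
  (D Dstar : 'I_n -> ('rV[R]_n -> R) -> 'rV[R]_n -> R)
  (D_def : forall i, D i = onedim_op i (a i) (b i))
  (Dstar_def : forall i, Dstar i = onedim_op i (astar i) (bstar i))
  (Dstar_adj : forall i, formal_adjoint Omega eta (D i) (Dstar i))
  (L_fact : forall f : 'rV[R]_n -> R, Ck 2 Omega f -> forall x, Omega x ->
     L f x = \sum_(i < n) Dstar i (D i f) x)
  (s : R) (s_gt0 : 0 < s) (s_lt1 : s < 1)
  (u : 'rV[R]_n -> R -> R) (v : 'I_n -> 'rV[R]_n -> R -> R)
  (u_C2 : Ck 2 (Omega `*` [set y : R | 0 < y]) (fun p => u p.1 p.2))
  (v_C2 : forall i, Ck 2 (Omega `*` [set y : R | 0 < y]) (fun p => v i p.1 p.2))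
  (u_sol : forall x (y : R), Omega x -> 0 < y -> extension_op L s u x y = 0)
  (CR_y : forall x (y : R), Omega x -> 0 < y ->
     y `^ (1 - 2 * s) * dy u x y = \sum_(i < n) Dstar i (v i ^~ y) x)
  (CR_x : forall i x (y : R), Omega x -> 0 < y ->
     D i (u ^~ y) x = y `^ (- (1 - 2 * s)) * dy (v i) x y)
  (CR_sym : forall i k x (y : R), Omega x -> 0 < y ->
     D k (v i ^~ y) x = D i (v k ^~ y) x) :
  forall i x (y : R), Omega x -> 0 < y ->
    - L (v i ^~ y) x + commutator (Dstar i) (D i) (v i ^~ y) x
    - (1 - 2 * s) / y * dy (v i) x y + dy (dy (v i)) x y = 0.
Proof.
move=> i x y Ox y0; pose c := 1 - 2 * s.
have nO z : Omega z -> \forall z' \near z, Omega z'.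
  by move=> Oz; exact: open_nbhs_nbhs.
have vC2 k : Ck 2 Omega (v k ^~ y) by exact: Ck_slice (v_C2 k).
have dyv (t : R) : 0 < t -> dy (v i) x t = t `^ c * D i (u ^~ t) x.
  move=> t0; rewrite CR_x// mulrA -powRD ?lt0r_neq0 ?implybT//.
  by rewrite subrr powRr0 mul1r.
(* By [dyv], the second term of this product rule is [c / y * dy (v i) x y], which cancels the first
   order term of the conjugate equation. *)
have Dy : is_derive y 1 (fun t : R => t `^ c * D i (u ^~ t) x)
    (y `^ c *: D i (dy u ^~ y) x + D i (u ^~ y) x *: (c * y `^ (c - 1))).
  rewrite D_def; apply: is_deriveM; first exact: is_derive1_powR.
  exact: (is_derive_onedim_op_y _ _ _ _ Omega_open u_C2).
have dyyv : dy (dy (v i)) x y =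
    y `^ c * D i (dy u ^~ y) x + D i (u ^~ y) x * (c * y `^ (c - 1)).
  rewrite /dy derive1E -[RHS](@derive_val _ _ _ _ _ _ _ Dy).
  apply: near_eq_derive; near=> t; apply: dyv; near: t.
  exact: lt_nbhsr.
(* For [k = i] the coefficients of [Dstar k] get differentiated; for [k != i] they are constant in
   direction [i]. *)
have DDstar k : derivable (Dstar k (v k ^~ y)) x (delta_mx 0 i).
  rewrite Dstar_def; have [->|ki] := eqVneq k i.
    exact: derivable_onedim_op (astar_C1 i) (bstar_C1 i) (vC2 i) Ox.
  by have [] := is_derive_onedim_op_neq _ _ _ _ _ (astar k) (bstar k) _ _
    Omega_open (vC2 k) Ox ki.
have Ddyu : y `^ c * D i (dy u ^~ y) x =
    \sum_(k < n) D i (Dstar k (v k ^~ y)) x.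
  (* The power of [y] is constant in [x], so it moves under [D i], where [CR_y] holds on a whole
     neighbourhood of [x]. *)
  rewrite D_def -onedim_opZ; last exact: (derivable_dy _ _ _ _ u_C2).
  rewrite -onedim_op_sum//; apply: near_eq_onedim_op.
  by near=> z; apply: CR_y => //; near: z; exact: nO.
have DDs k : k != i ->
    D i (Dstar k (v k ^~ y)) x = Dstar k (D k (v i ^~ y)) x.
  move=> ki; rewrite D_def Dstar_def.
  rewrite (onedim_op_comm _ _ Omega)//.
  (* [CR_sym] is used near [x] and not only at [x], since [Dstar k] differentiates both sides. *)
  apply: near_eq_onedim_op; near=> z.
  by rewrite -D_def CR_sym//; near: z; exact: nO.
rewrite (bigD1 i)//= (eq_bigr (fun k => Dstar k (D k (v i ^~ y)) x) DDs) in Ddyu.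
(* With [k = i] split off on both sides, the sums over [k != i] cancel and the commutator absorbs
   the rest of the second order part. The first order terms agree because [y ^ (c - 1)] is
   [y ^ c / y]. *)
rewrite L_fact// (bigD1 i)//= dyyv Ddyu /commutator.
rewrite dyv// (@powRD _ y c (-1)) ?lt0r_neq0 ?implybT// powR_inv1 ?ltW//.
rewrite -/c; field.
exact: lt0r_neq0.
Unshelve. all: by end_near. Qed.
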